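(* Let $\Omega\subseteq\mathbb{R}^n$ be an open connected set contained in the open ball $\mathbb{B}_R(0)$ and star-shaped with respect to the open ball $\mathbb{B}_\rho(0)$, where $\rho,R>0$. The gauge function $g$ of $\Omega$ satisfies $$ \forall x,y\in\mathbb{R}^n:\quad |g(x)-g(y)|\le\frac1\rho\|x-y\|. $$ The expansion function $s$ of $\Omega$ satisfies $$ \forall x,y\in\mathbb{R}^n:\quad |s(x)-s(y)|\le\frac{R^2}{\rho}\|x-y\|. $$
   Context: $\|\cdot\|$ is the Euclidean norm and $\mathbb{B}_t(0)$ the open Euclidean ball of radius $t$ about the origin. $\Omega$ is star-shaped with respect to a subset $B\subseteq\Omega$ if for all $x\in\Omega$, $x_0\in B$ and $\lambda\in[0,1]$ one has $(1-\lambda)x+\lambda x_0\in\Omega$. Gauge function: $g:\mathbb{R}^n\to\mathbb{R}$, $g(x):=\inf\{t>0: x\in t\Omega\}$. Expansion function: $s:\mathbb{R}^n\to\mathbb{R}$, $s(0):=0$ and $s(x):=\|x\|\,\sup\{t>0: t\,x/\|x\|\in\Omega\}$ for $x\ne0$. *)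

(* Defs.v *)
From mathcomp Require Import all_boot all_order all_algebra.
From mathcomp Require Import all_classical all_reals all_analysis.

Set Implicit Arguments.
Unset Strict Implicit.
Unset Printing Implicit Defensive.

Import Order.TTheory GRing.Theory Num.Theory.
Import numFieldNormedType.Exports.
Local Open Scope classical_set_scope.
Local Open Scope ring_scope.

(* The norm `|x| that the library puts on 'rV[R]_n is the sup norm, so the
   Euclidean norm and its balls are defined separately.  The library's topology
   on 'rV[R]_n is the same for both norms. *)
Definition enorm (R : realType) (n : nat) (x : 'rV[R]_n) : R :=
  Num.sqrt (\sum_(i < n) x 0 i ^+ 2).

Definition eball (R : realType) (n : nat) (t : R) : set 'rV[R]_n :=
  [set x | enorm x < t].

Definition star_shaped_wrt (R : realType) (n : nat) (B Omega : set 'rV[R]_n) :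
  Prop :=
  B `<=` Omega /\
  forall (x x0 : 'rV[R]_n) (lambda : R),
    Omega x -> B x0 -> 0 <= lambda <= 1 ->
    Omega ((1 - lambda) *: x + lambda *: x0).

(* [inf] and [sup] are total on [set R], with value 0 on sets that are empty or
   unbounded.  Both sets below are nonempty and suitably bounded as soon as
   Omega is bounded and contains a Euclidean ball centred at 0. *)
Definition gauge_function (R : realType) (n : nat) (Omega : set 'rV[R]_n)
  (x : 'rV[R]_n) : R :=
  inf [set t : R | 0 < t /\ [set t *: y | y in Omega] x].

Definition expansion_function (R : realType) (n : nat) (Omega : set 'rV[R]_n)
  (x : 'rV[R]_n) : R :=
  if x == 0 then 0
  else enorm x * sup [set t : R | 0 < t /\ Omega (t *: ((enorm x)^-1 *: x))].

(* Main.v *)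
Require Import Defs.
From mathcomp Require Import all_boot all_order all_algebra.
From mathcomp Require Import all_classical all_reals all_analysis.
From mathcomp Require Import ring lra.

Set Implicit Arguments.
Unset Strict Implicit.
Unset Printing Implicit Defensive.

Import Order.TTheory GRing.Theory Num.Theory.
Import numFieldNormedType.Exports.
Local Open Scope classical_set_scope.
Local Open Scope ring_scope.

(** Write g for the gauge function, s for the expansion function and | | for the
    Euclidean norm.

    The bound on g is a quantified form of subadditivity.  If x = t y with y in
    Omega, then moving x by a vector v costs at most |v| / rho in the gauge: for
    every r > |v| / rho the vector v / r lies in the ball of radius rho, and
    x + v = t y + r (v / r) is t + r times a convex combination of y with that
    point, so star-shapedness puts x + v in (t + r) Omega
    ([gauge_function_le_add]).

    The bound on s follows from the one on g by inversion in the unit sphere.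
    Writing x' = x / |x|^2, the ray condition defining s at x is the reciprocal
    of the one defining g at x', hence s(x) = 1 / g(x')
    ([gauge_function_inversion]).  Inversion satisfies
    |x' - y'| = |x - y| / (|x| |y|) ([enorm_inversion]), so
<<
    |s(x) - s(y)| = s(x) s(y) |g(x') - g(y')|
                 <= s(x) s(y) |x - y| / (rho |x| |y|)
>>
    and s(x) <= Rad |x| because Omega lies in the ball of radius Rad.  When one of
    the points is the origin, where inversion is undefined, that last estimate
    suffices by itself, since rho <= Rad as soon as a nonzero vector exists. *)

(** * The Euclidean norm *)

Lemma enorm_ge0 (R : realType) (n : nat) (x : 'rV[R]_n) : 0 <= enorm x.
Proof. exact: sqrtr_ge0. Qed.

Lemma enorm_gt0 (R : realType) (n : nat) (x : 'rV[R]_n) :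
  x != 0 -> 0 < enorm x.
Proof.
move=> x0; rewrite sqrtr_gt0 lt_def sumr_ge0 ?andbT => [|i _]; last first.
  exact: sqr_ge0.
apply: contra x0; rewrite psumr_eq0 => [/allP s0|i _]; last exact: sqr_ge0.
apply/eqP/rowP => i; rewrite mxE; apply/eqP.
by have := s0 i (mem_index_enum i); rewrite sqrf_eq0.
Qed.

Lemma sqr_enorm (R : realType) (n : nat) (x : 'rV[R]_n) :
  enorm x ^+ 2 = \sum_(i < n) x 0 i ^+ 2.
Proof. by rewrite sqr_sqrtr// sumr_ge0// => i _; exact: sqr_ge0. Qed.

Lemma enormZ (R : realType) (n : nat) (a : R) (x : 'rV[R]_n) :
  enorm (a *: x) = `|a| * enorm x.
Proof.
rewrite /enorm -sqrtr_sqr -sqrtrM ?sqr_ge0//; congr Num.sqrt.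
by rewrite mulr_sumr; apply: eq_bigr => i _; rewrite mxE exprMn.
Qed.

Lemma enorm0 (R : realType) (n : nat) : enorm (0 : 'rV[R]_n) = 0.
Proof. by rewrite -(scale0r 0) enormZ normr0 mul0r. Qed.

Lemma enorm_distC (R : realType) (n : nat) (x y : 'rV[R]_n) :
  enorm (x - y) = enorm (y - x).
Proof. by rewrite -opprB -scaleN1r enormZ normrN1 mul1r. Qed.

Lemma sqr_enorm_lincombB (R : realType) (n : nat) (a b : R) (x y : 'rV[R]_n) :
  enorm (a *: x - b *: y) ^+ 2 =
  a ^+ 2 * enorm x ^+ 2 - 2 * a * b * (\sum_(i < n) x 0 i * y 0 i)
  + b ^+ 2 * enorm y ^+ 2.
Proof.
rewrite !sqr_enorm !mulr_sumr -sumrB -big_split /=.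
by apply: eq_bigr => i _; rewrite !mxE; ring.
Qed.

Lemma enorm_inversion (R : realType) (n : nat) (x y : 'rV[R]_n) :
  x != 0 -> y != 0 ->
  enorm (enorm x ^- 2 *: x - enorm y ^- 2 *: y)
  = enorm (x - y) / (enorm x * enorm y).
Proof.
move=> /enorm_gt0 x0 /enorm_gt0 y0.
apply/eqP; rewrite -(@eqrXn2 _ 2) ?enorm_ge0// ?divr_ge0 ?mulr_ge0 ?enorm_ge0//.
have -> : x - y = 1 *: x - 1 *: y by rewrite !scale1r.
rewrite expr_div_n !sqr_enorm_lincombB.
by apply/eqP; field; rewrite !gt_eqF.
Qed.

(** * The gauge function *)

Lemma has_lbound_gauge (R : realType) (n : nat) (Omega : set 'rV[R]_n)
    (x : 'rV[R]_n) :
  has_lbound [set t : R | 0 < t /\ [set t *: y | y in Omega] x].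
Proof. by exists 0 => t [/ltW]. Qed.

Lemma eball_scale (R : realType) (n : nat) (rho r : R) (v : 'rV[R]_n) :
  0 < r -> enorm v < r * rho -> eball rho (r^-1 *: v).
Proof.
move=> r0 vr; rewrite /eball /= enormZ gtr0_norm ?invr_gt0//.
by rewrite ltr_pdivrMl.
Qed.

Lemma gauge_nonempty (R : realType) (n : nat) (Omega : set 'rV[R]_n) (rho : R)
    (x : 'rV[R]_n) :
  0 < rho -> eball rho `<=` Omega ->
  [set t : R | 0 < t /\ [set t *: y | y in Omega] x] !=set0.
Proof.
move=> rho0 BO; set r := (enorm x + 1) / rho.
have r0 : 0 < r by rewrite divr_gt0// ltr_wpDl ?enorm_ge0.
exists r; split => //; exists (r^-1 *: x).
  by apply: BO; apply: eball_scale => //; rewrite divfK ?gt_eqF// ltrDl.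
by rewrite scalerA divff ?scale1r// gt_eqF.
Qed.

(** Subadditivity of the gauge holds even though Omega need not be convex, because
    one of the two summands is measured by the gauge |v| / rho of the ball with
    respect to which Omega is star-shaped. *)
Lemma gauge_function_le_add (R : realType) (n : nat) (Omega : set 'rV[R]_n)
    (rho : R) (x v : 'rV[R]_n) :
  0 < rho -> star_shaped_wrt (eball rho) Omega ->
  gauge_function Omega (x + v) <= gauge_function Omega x + enorm v / rho.
Proof.
move=> rho0 [BO star]; rewrite -lerBlDr.
apply: lb_le_inf; first exact: gauge_nonempty BO.
move=> t [t0 [y Oy tyx]]; rewrite lerBlDr; apply/ler_addgt0Pr => e e0.
(* The slack e makes r positive and puts v / r inside the ball, which is open. *)
set r := enorm v / rho + e.
have r0 : 0 < r by rewrite ltr_wpDl// divr_ge0 ?enorm_ge0// ltW.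
have tr0 : 0 < t + r by rewrite addr_gt0.
rewrite -addrA -/r; apply: ge_inf; first exact: has_lbound_gauge.
split => //; set l := r / (t + r).
exists ((1 - l) *: y + l *: (r^-1 *: v)); last first.
  have ty : (t + r) * (1 - l) = t by rewrite /l; field; rewrite gt_eqF.
  have rv : (t + r) * l / r = 1 by rewrite /l; field; rewrite !gt_eqF.
  by rewrite scalerDr !scalerA ty rv scale1r tyx.
apply: star => //.
- apply: eball_scale => //; rewrite -ltr_pdivrMr//.
  by rewrite /r ltrDl.
- by rewrite /l divr_ge0 ?ltW//= ltr_pdivrMr// mul1r ltrDr.
Qed.

Lemma gauge_function_lipschitz (R : realType) (n : nat) (Omega : set 'rV[R]_n)
    (rho : R) (x y : 'rV[R]_n) :
  0 < rho -> star_shaped_wrt (eball rho) Omega ->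
  `|gauge_function Omega x - gauge_function Omega y| <= enorm (x - y) / rho.
Proof.
move=> rho0 star; rewrite ler_norml; apply/andP; split.
- rewrite lerNl opprB lerBlDl enorm_distC.
  by have := gauge_function_le_add x (y - x) rho0 star; rewrite addrC subrK.
- rewrite lerBlDl.
  by have := gauge_function_le_add y (x - y) rho0 star; rewrite addrC subrK.
Qed.

(** * The expansion function *)

(** Taking reciprocals reverses the order of the positive reals, so it exchanges
    suprema and infima; the factor c absorbs the rescaling between a ray
    parametrised by arc length and by another vector. *)
Lemma inf_reciprocal (R : realType) (A : set R) (c : R) :
  0 < c -> A !=set0 -> has_ubound A -> (forall t, A t -> 0 < t) ->
  inf [set t | 0 < t /\ A (c * t)^-1] = (c * sup A)^-1.
Proof.
move=> c0 [a Aa] Aub Apos; set T := [set t | _].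
have supA t : A t -> t <= sup A by move=> At; exact: ub_le_sup.
have sup0 : 0 < sup A by exact: lt_le_trans (Apos _ Aa) (supA _ Aa).
have TA t : A t -> T (c * t)^-1.
  move=> At; have t0 := Apos _ At.
  split; first by rewrite invr_gt0 mulr_gt0.
  by have -> : (c * (c * t)^-1)^-1 = t by field; rewrite !gt_eqF.
have lbT : has_lbound T by exists 0 => t [/ltW].
have infT : (c * sup A)^-1 <= inf T.
  apply: lb_le_inf; first by exists (c * a)^-1; exact: TA.
  move=> t [t0 /supA].
  by rewrite invfM ler_pdivrMl// -invf_ple ?posrE ?mulr_gt0.
have inf0 : 0 < inf T by rewrite (lt_le_trans _ infT)// invr_gt0 mulr_gt0.
apply/eqP; rewrite eq_le infT andbT.
rewrite -invf_pge ?posrE ?mulr_gt0// mulrC -ler_pdivlMr//.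
apply: ge_sup; first by exists a.
move=> t At; have t0 := Apos _ At.
rewrite ler_pdivlMr// mulrC invf_pge ?posrE ?mulr_gt0//.
exact: ge_inf (TA _ At).
Qed.

Section ray.
Context {R : realType} {n : nat} (Omega : set 'rV[R]_n) (rho Rad : R).
Hypotheses (rho_gt0 : 0 < rho) (BO : eball rho `<=` Omega).
Hypothesis Omega_bounded : Omega `<=` eball Rad.
Variable x : 'rV[R]_n.
Hypothesis x_neq0 : x != 0.

Let ray := [set t : R | 0 < t /\ Omega (t *: ((enorm x)^-1 *: x))].

Let enorm_ray t : 0 < t -> enorm (t *: ((enorm x)^-1 *: x)) = t.
Proof.
move=> t0; have x0 := enorm_gt0 x_neq0.
by rewrite !enormZ gtr0_norm// gtr0_norm ?invr_gt0// mulVf ?mulr1 ?gt_eqF.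
Qed.

Let ray_lt_Rad t : ray t -> t < Rad.
Proof. by move=> [t0 /Omega_bounded]; rewrite /eball /= enorm_ray. Qed.

Let ray_lt_rho t : 0 < t -> t < rho -> ray t.
Proof. by move=> t0 tr; split => //; apply: BO; rewrite /eball /= enorm_ray. Qed.

Let ray_nonempty : ray !=set0.
Proof. by exists (rho / 2); apply: ray_lt_rho; move: rho_gt0; lra. Qed.

Let ray_ubound : has_ubound ray.
Proof. by exists Rad => t /ray_lt_Rad/ltW. Qed.

(** If Rad < rho, the ray through x would leave the ball of radius Rad, at
    parameter Rad, while still inside Omega; a nonzero x is needed, as in
    dimension 0 every ball of positive radius is the whole space. *)
Lemma radius_le : rho <= Rad.
Proof.
rewrite leNgt; apply/negP => Rr.
have Rad0 : 0 < Rad.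
  by have [t tray] := ray_nonempty; apply: lt_trans (ray_lt_Rad tray); case: tray.
by have := ray_lt_Rad (ray_lt_rho Rad0 Rr); rewrite ltxx.
Qed.

Lemma expansion_function_gt0 : 0 < expansion_function Omega x.
Proof.
rewrite /expansion_function (negbTE x_neq0) mulr_gt0 ?enorm_gt0//.
have [t tray] := ray_nonempty.
by apply: lt_le_trans (ub_le_sup ray_ubound tray); case: tray.
Qed.

Lemma expansion_function_le : expansion_function Omega x <= Rad * enorm x.
Proof.
rewrite /expansion_function (negbTE x_neq0) mulrC ler_pM2r ?enorm_gt0//.
by apply: ge_sup => // t /ray_lt_Rad/ltW.
Qed.

(** With u = x / |x|, the inverse point u / |x| lies in t Omega exactly when
    u / (|x| t) lies in Omega: the two functions are governed by reciprocal
    parameters on the same ray. *)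
Lemma gauge_function_inversion :
  gauge_function Omega (enorm x ^- 2 *: x) = (expansion_function Omega x)^-1.
Proof.
have x0 := enorm_gt0 x_neq0.
rewrite /expansion_function (negbTE x_neq0) -inf_reciprocal//; last first.
  by move=> t [].
rewrite /gauge_function; congr inf; apply/seteqP; split => t /=.
- move=> [t0 [y Oy tyx]]; split => //; split; first by rewrite invr_gt0 mulr_gt0.
  suff -> : (enorm x * t)^-1 *: ((enorm x)^-1 *: x) = y by [].
  rewrite -[y]scale1r -(@mulVf _ t) ?gt_eqF// -scalerA tyx !scalerA.
  by congr (_ *: _); field; rewrite !gt_eqF.
- move=> [t0 [_ O]]; split => //.
  exists ((enorm x * t)^-1 *: ((enorm x)^-1 *: x)) => //.
  by rewrite !scalerA; congr (_ *: _); field; rewrite !gt_eqF.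
Qed.

End ray.

(** The case of the Lipschitz bound in which inversion is undefined at one of
    the points. *)
Lemma expansion_function_le_norm (R : realType) (n : nat)
    (Omega : set 'rV[R]_n) (rho Rad : R) (x : 'rV[R]_n) :
  0 < rho -> eball rho `<=` Omega -> Omega `<=` eball Rad ->
  `|expansion_function Omega x - expansion_function Omega 0|
  <= Rad ^+ 2 / rho * enorm x.
Proof.
move=> rho0 BO OB; rewrite [expansion_function _ 0]/expansion_function eqxx subr0.
have [->|x0] := eqVneq x 0.
  by rewrite /expansion_function eqxx normr0 enorm0 mulr0.
have rR := radius_le rho0 BO OB x0.
rewrite (gtr0_norm (expansion_function_gt0 rho0 BO OB x0)).
apply: le_trans (expansion_function_le rho0 BO OB x0) _.
rewrite ler_pM2r ?enorm_gt0// ler_pdivlMr// expr2 ler_pM2l//.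
exact: lt_le_trans rR.
Qed.

Lemma expansion_function_lipschitz (R : realType) (n : nat)
    (Omega : set 'rV[R]_n) (rho Rad : R) (x y : 'rV[R]_n) :
  0 < rho -> star_shaped_wrt (eball rho) Omega -> Omega `<=` eball Rad ->
  `|expansion_function Omega x - expansion_function Omega y|
  <= Rad ^+ 2 / rho * enorm (x - y).
Proof.
move=> rho0 star OB; have BO := star.1.
have [->|y0] := eqVneq y 0.
  by rewrite subr0; exact: expansion_function_le_norm.
have [->|x0] := eqVneq x 0.
  by rewrite distrC enorm_distC subr0; exact: expansion_function_le_norm.
have nx := enorm_gt0 x0; have ny := enorm_gt0 y0.
have := gauge_function_lipschitz
  (enorm x ^- 2 *: x) (enorm y ^- 2 *: y) rho0 star.
rewrite (gauge_function_inversion rho0 BO OB x0).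
rewrite (gauge_function_inversion rho0 BO OB y0) enorm_inversion//.
have := expansion_function_le rho0 BO OB x0.
have := expansion_function_le rho0 BO OB y0.
have := expansion_function_gt0 rho0 BO OB x0.
have := expansion_function_gt0 rho0 BO OB y0.
move: (expansion_function _ x) (expansion_function _ y) => a b b0 a0 bR aR gL.
have -> : a - b = a * b * - (a^-1 - b^-1) by field; rewrite !gt_eqF.
have ab0 : 0 < a * b by rewrite mulr_gt0.
rewrite normrM normrN (gtr0_norm ab0).
apply: le_trans (ler_wpM2l (ltW ab0) gL) _.
have -> : Rad ^+ 2 / rho * enorm (x - y) =
    (Rad * enorm x) * (Rad * enorm y)
    * (enorm (x - y) / (enorm x * enorm y) / rho).
  by field; rewrite !gt_eqF.
apply: ler_wpM2r; last by apply: ler_pM => //; exact: ltW.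
by rewrite !divr_ge0 ?mulr_ge0 ?enorm_ge0// ltW.
Qed.

Theorem theorem2p10 (R : realType) (n : nat) (Omega : set 'rV[R]_n)
    (rho Rad : R) (rho_gt0 : 0 < rho) (Rad_gt0 : 0 < Rad)
    (Omega_open : open Omega) (Omega_connected : connected Omega)
    (Omega_bounded : Omega `<=` eball Rad)
    (Omega_star : star_shaped_wrt (eball rho) Omega) :
  (forall x y : 'rV[R]_n,
     `|gauge_function Omega x - gauge_function Omega y|
       <= 1 / rho * enorm (x - y)) /\
  (forall x y : 'rV[R]_n,
     `|expansion_function Omega x - expansion_function Omega y|
       <= Rad ^+ 2 / rho * enorm (x - y)).
Proof.
split=> x y.
- by rewrite div1r mulrC; exact: gauge_function_lipschitz.
- exact: expansion_function_lipschitz.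
Qed.
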